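(* The set of quasisymmetric functions $\{N_\alpha\}$, as $\alpha$ ranges over all compositions (including the empty composition $\mathbf{0}$), forms a $\mathbb{Z}$-basis for the ring $\mathrm{QSym}$ of quasisymmetric functions with integer coefficients.
   Context: A composition $\alpha=(\alpha_1,\dots,\alpha_m)$ is a finite (possibly empty) sequence of positive integers; $\ell(\alpha)=m$ is its length and $|\alpha|=\alpha_1+\cdots+\alpha_m$ its weight. The empty composition is denoted $\mathbf{0}$. For compositions of the same weight $n$, $\beta$ refines $\alpha$ ($\beta\preccurlyeq\alpha$) if the set of proper partial sums of $\alpha$ (a subset of $\{1,\dots,n-1\}$) is contained in that of $\beta$. $\mathrm{QSym}$ is the ring of quasisymmetric functions in the ordered variables $x_1,x_2,\dots$, with monomial basis $\mathbf{x}^\alpha=\sum_{1\le i_1<\cdots<i_m}x_{i_1}^{\alpha_1}\cdots x_{i_m}^{\alpha_m}$ and fundamental basis $L_\alpha=\sum_{\beta\preccurlyeq\alpha}\mathbf{x}^\beta$ (with $L_{\mathbf 0}=1$). A permutation of a finite set $X$ of positive integers is a sequence $\pi$ listing each element of $X$ exactly once; $C(\pi)$ is the composition whose parts are the lengths of the successive maximal increasing runs of $\pi$. A labeled poset $P$ is a partial order $\le_P$ on a finite set of positive integers (the labels). $\mathcal{L}(P)$ is the set of linear extensions of $P$, i.e. permutations of the label set in which $x$ appears before $y$ whenever $x<_P y$. The quasisymmetric function of $P$ is $F(P)=\sum_{\pi\in\mathcal{L}(P)}L_{C(\pi)}$. $P\oplus Q$ denotes the ordinal sum of posets (all elements of $P$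 lie below all elements of $Q$). For a nonempty composition $\alpha$ with $\ell(\alpha)=m$, let $P_\alpha=A_1\oplus\cdots\oplus A_m$, where $A_i$ is an antichain with $\alpha_i$ elements, labeled by $1,\dots,|\alpha|$ as follows: first the elements of $A_2,A_4,\dots$ are numbered consecutively, followed by the elements of $A_1,A_3,\dots$. Define $N_\alpha=F(P_\alpha)$, and $N_{\mathbf 0}=1$. *)

(* Defs.v *)
From HB Require Import structures.
From mathcomp Require Import all_boot all_order all_algebra.
From mathcomp Require Import finmap zify.
From mathcomp Require Import boolp functions.

Set Implicit Arguments.
Unset Strict Implicit.
Unset Printing Implicit Defensive.

Import GRing.Theory.
Local Open Scope fset_scope.
Local Open Scope ring_scope.

Definition is_comp (s : seq nat) : bool := all (ltn 0) s.

Definition composition := {s : seq nat | is_comp s}.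

Definition psums (s : seq nat) : seq nat :=
  [seq sumn (take k s) | k <- iota 1 (size s).-1].

Definition refines (b a : seq nat) : bool :=
  (sumn b == sumn a) && all (fun k => k \in psums b) (psums a).

(* The compositions of n: one of n.+1 either starts with a part 1, or is
   obtained by increasing the first part of a composition of n. *)
Fixpoint comps (n : nat) : seq (seq nat) :=
  if n is n'.+1 then
    [seq 1%N :: s | s <- comps n']
    ++ [seq (head 0%N s).+1 :: behead s | s <- comps n' & s != [::]]
  else [:: [::]].

Lemma mem_comps n s : (s \in comps n) = is_comp s && (sumn s == n).
Proof.
elim: n s => [|n IHn] s; first by
  rewrite inE; case: s => [|[|k] t] //=; rewrite addSn andbF.
rewrite [comps _]/= mem_cat; apply/orP/andP => [[]|].
- by case/mapP => t; rewrite IHn => /andP[ct /eqP <-] ->; rewrite /= add1n.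
- case/mapP => t; rewrite mem_filter IHn => /and3P[+ + /eqP <-] ->.
  by case: t => // k t _ /= /andP[_ ct]; rewrite addSn.
- case: s => [|[|[|k]] t] [] //= ct.
  + rewrite add1n eqSS => st; left; rewrite mem_map => [|u v []] //.
    by rewrite IHn st andbT.
  + rewrite addSn eqSS => st; right; apply/mapP; exists (k.+1 :: t) => //.
    by rewrite mem_filter IHn /= ct.
Qed.

Lemma comps_uniq n : uniq (comps n).
Proof.
elim: n => //= n IHn; rewrite cat_uniq; apply/and3P; split.
- by rewrite map_inj_uniq // => u v [].
- apply/hasPn => s /mapP[[|k t]]; rewrite mem_filter mem_comps //=.
  case: k => // k _ ->; by apply/mapP => -[].
- rewrite map_inj_in_uniq ?filter_uniq // => u v.
  rewrite !mem_filter.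
  by case: u v => [|k t] [|j u] //= _ _ [-> ->].
Qed.

(* Exponent vectors of monomials.  Variables are numbered from 0: the index j
   stands for the variable x_(j+1). *)
Definition monom := {fsfun nat -> nat with 0%N}.

(* x_(i_1)^(a_1) ... x_(i_m)^(a_m), for i without repetitions. *)
Definition mkmonom (i a : seq nat) : monom :=
  [fsfun j in [fset k in i] => nth 0%N a (index j i)].

Definition mdegree (m : monom) : nat := \sum_(j <- finsupp m) m j.

(* The nonzero exponents of a monomial, by increasing variable. *)
Definition exponents (m : monom) : seq nat :=
  [seq m j | j <- sort leq (finsupp m)].

(* Formal series in x_1, x_2, ... with integer coefficients: the value at a
   monomial is its coefficient.  Addition is pointwise, but multiplication of
   series is not: the unit of the ring of series is [series1]. *)
Definition series := monom -> int.

HB.instance Definition _ := GRing.Zmodule.copy series (monom -> int).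

Definition series1 : series := fun m => (m == [fsfun])%:R.

Definition quasisymmetric (f : series) : Prop :=
  (exists d : nat, forall m, (d < mdegree m)%N -> f m = 0) /\
  (forall a i j : seq nat, is_comp a ->
     sorted ltn i -> sorted ltn j -> size i = size a -> size j = size a ->
     f (mkmonom i a) = f (mkmonom j a)).

(* A monomial m occurs in x^a, then with coefficient 1, iff m is mkmonom i a
   for an increasing sequence i: see [exponentsP]. *)
Definition monomialQ (a : seq nat) : series := fun m => (exponents m == a)%:R.

Lemma finsupp_mkmonom (i a : seq nat) : is_comp a -> size i = size a ->
  finsupp (mkmonom i a) =i i.
Proof.
move=> ca si j; rewrite mem_finsupp fsfunE inE /=.
case: ifP => // ji; rewrite -lt0n.
by apply: (allP ca); rewrite mem_nth // -si index_mem.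
Qed.

Lemma exponentsP (a : seq nat) (m : monom) : is_comp a ->
  reflect (exists i, [/\ sorted ltn i, size i = size a & m = mkmonom i a])
          (exponents m == a).
Proof.
move=> ca; apply: (iffP eqP) => [<-|[i [si sz ->]]].
  exists (sort leq (finsupp m)); split.
  - by rewrite ltn_sorted_uniq_leq sort_uniq fset_uniq sort_sorted //; exact: leq_total.
  - by rewrite size_map.
  - apply/fsfunP => j; rewrite fsfunE inE /= mem_sort.
    case: ifP => [jm|/negbT jm]; last by rewrite fsfun_dflt.
    have js : j \in sort leq (finsupp m) by rewrite mem_sort.
    by rewrite (nth_map 0%N) ?index_mem // nth_index.
have ui : uniq i by apply: sorted_uniq si; [exact: ltn_trans | exact: ltnn].
rewrite /exponents.
have -> : sort leq (finsupp (mkmonom i a)) = i.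
  apply: (sorted_eq leq_trans anti_leq).
  - by apply: sort_sorted; exact: leq_total.
  - by move: si; rewrite ltn_sorted_uniq_leq => /andP[].
  - rewrite perm_sort; apply: uniq_perm => //; first exact: fset_uniq.
    exact: finsupp_mkmonom.
apply: (@eq_from_nth _ 0%N); rewrite size_map // => k ki.
rewrite (nth_map 0%N) // fsfunE inE /= mem_nth // index_uniq //.
Qed.

Definition fundamentalQ (a : seq nat) : series :=
  \sum_(b <- comps (sumn a) | refines b a) monomialQ b.

Lemma fundamentalQ_nil : fundamentalQ [::] = series1.
Proof.
rewrite /fundamentalQ /= big_cons big_nil /= addr0.
apply/funext => m; rewrite /monomialQ /series1; congr (_%:R); congr nat_of_bool.
apply/(exponentsP m (erefl : is_comp [::]))/eqP => [[i [_ /size0nil -> ->]]|->].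
  by apply/fsfunP => j; rewrite !fsfunE inE.
by exists [::]; split => //; apply/fsfunP => j; rewrite !fsfunE inE.
Qed.

(* [run_lengths x k s]: the lengths of the maximal increasing runs of a word
   ending in x :: s, k being the length of the run so far, up to x. *)
Fixpoint run_lengths (x k : nat) (s : seq nat) : seq nat :=
  if s is y :: s' then
    if (x < y)%N then run_lengths y k.+1 s' else k :: run_lengths y 1 s'
  else [:: k].

Definition run_comp (p : seq nat) : seq nat :=
  if p is x :: s then run_lengths x 1 s else [::].

Record labeled_rel := LabeledRel {
  labels : {fset nat};
  lrel : rel nat
}.

Definition is_labeled_poset (P : labeled_rel) : Prop :=
  [/\ (forall x, x \in labels P -> (0 < x)%N),
      (forall x y, lrel P x y -> (x \in labels P) && (y \in labels P)),
      {in labels P, reflexive (lrel P)},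
      antisymmetric (lrel P) &
      transitive (lrel P)].

Record labeled_poset := LabeledPoset {
  poset_rel :> labeled_rel;
  _ : is_labeled_poset poset_rel
}.

Definition linear_extensions (P : labeled_poset) : seq (seq nat) :=
  [seq p <- permutations (labels P) |
     all (fun x => all (fun y =>
       (x != y) && lrel P x y ==> (index x p < index y p)%N) (labels P))
       (labels P)].

Definition posetQ (P : labeled_poset) : series :=
  \sum_(p <- linear_extensions P) fundamentalQ (run_comp p).

Definition empty_rel : labeled_rel := LabeledRel fset0 (fun _ _ => false).

Definition antichain (s : seq nat) : labeled_rel :=
  LabeledRel [fset x in s] (fun x y => (x \in s) && (x == y)).

(* Meaningful when P and Q have disjoint sets of labels. *)
Definition ordinal_sum (P Q : labeled_rel) : labeled_rel :=
  LabeledRel (labels P `|` labels Q)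
    (fun x y => [|| lrel P x y, lrel Q x y | (x \in labels P) && (y \in labels Q)]).

Lemma empty_poset : is_labeled_poset empty_rel.
Proof. by split. Qed.

Lemma antichain_poset s : all (ltn 0) s -> is_labeled_poset (antichain s).
Proof.
move=> /allP s0; split => /=.
- by move=> x; rewrite inE => /s0.
- by move=> x y /andP[xs /eqP <-]; rewrite !inE /= xs.
- by move=> x; rewrite inE => /= ->; rewrite eqxx.
- by move=> x y /andP[/andP[_ /eqP]].
- by move=> y x z /andP[xs /eqP ->].
Qed.

Lemma ordinal_sum_poset P Q : [disjoint labels P & labels Q]%fset ->
  is_labeled_poset P -> is_labeled_poset Q ->
  is_labeled_poset (ordinal_sum P Q).
Proof.
move=> /fdisjointP dPQ [P0 Pd Pr Pa Pt] [Q0 Qd Qr Qa Qt]; split => /=.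
- by move=> x; rewrite inE => /orP[/P0|/Q0].
- move=> x y; rewrite !inE => /or3P[/Pd|/Qd|] /andP[-> ->] //=; rewrite ?orbT //.
- by move=> x; rewrite inE => /orP[/Pr|/Qr] ->; rewrite ?orbT.
- have PQ x : x \in labels P -> x \in labels Q -> False.
    by move=> /dPQ /negP.
  move=> x y /andP[/or3P[xy|xy|/andP[xy xy']] /or3P[yx|yx|/andP[yx yx']]].
  + by apply: Pa; rewrite xy.
  + by case/andP: (Pd _ _ xy) => /PQ a _; case/andP: (Qd _ _ yx) => _ /a.
  + by case/andP: (Pd _ _ xy) => /PQ a _; case: a.
  + by case/andP: (Qd _ _ xy) => h _; case/andP: (Pd _ _ yx) => _ /PQ[].
  + by apply: Qa; rewrite xy.
  + by case/andP: (Qd _ _ xy) => _ /(PQ _ yx).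
  + by case/andP: (Pd _ _ yx) => /PQ[].
  + by case/andP: (Qd _ _ yx) => _ /(PQ _ xy).
  + by case: (PQ _ xy yx').
- have PQ x : x \in labels P -> x \in labels Q -> False.
    by move=> /dPQ /negP.
  move=> y x z /or3P[xy|xy|/andP[xy xy']] /or3P[yz|yz|/andP[yz yz']].
  + by rewrite (Pt _ _ _ xy yz).
  + by case/andP: (Pd _ _ xy) => _ /PQ[]; case/andP: (Qd _ _ yz).
  + by case/andP: (Pd _ _ xy) => ->; rewrite yz' !orbT.
  + by case/andP: (Qd _ _ xy) => _ h; case/andP: (Pd _ _ yz) => /PQ[].
  + by rewrite (Qt _ _ _ xy yz) orbT.
  + by case/andP: (Qd _ _ xy) => _ /(PQ _ yz).
  + by case/andP: (Pd _ _ yz) => /PQ[].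
  + by case/andP: (Qd _ _ yz) => _ ->; rewrite xy !orbT.
  + by case: (PQ _ yz xy').
Qed.

(* The number of labels used before those of A_(i+1).  Positions in a are
   numbered from 0 here, so A_2, A_4, ... sit at the odd positions. *)
Definition label_offset (a : seq nat) (i : nat) : nat :=
  (\sum_(j < i | odd j == odd i) nth 0 a j
   + (if odd i then 0 else \sum_(j < size a | odd j) nth 0 a j))%N.

Definition block (a : seq nat) (i : nat) : seq nat :=
  iota (label_offset a i).+1 (nth 0%N a i).

Definition N_rel (a : seq nat) : labeled_rel :=
  \big[ordinal_sum/empty_rel]_(i < size a) antichain (block a i).

Lemma partial_sum_le (p : pred nat) (f : nat -> nat) i n : (i < n)%N -> p i ->
  (\sum_(k < i | p k) f k + f i <= \sum_(k < n | p k) f k)%N.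
Proof.
elim: n => // n IHn; rewrite ltnS leq_eqVlt => /predU1P[->|lin] pi.
  by rewrite [leqRHS]big_mkcond big_ord_recr /= pi -big_mkcond.
apply: leq_trans (IHn lin pi) _.
by rewrite [leqRHS]big_mkcond big_ord_recr /= -big_mkcond leq_addr.
Qed.

Lemma label_offset_parity a i j : (i < j)%N -> odd i = odd j ->
  (label_offset a i + nth 0 a i <= label_offset a j)%N.
Proof.
move=> ij oij; rewrite /label_offset oij addnAC leq_add2r.
by apply: (@partial_sum_le (fun k => odd k == odd j)) => //; rewrite oij.
Qed.

Lemma label_offset_odd a i j : (i < size a)%N -> odd i -> ~~ odd j ->
  (label_offset a i + nth 0 a i <= label_offset a j)%N.
Proof.
move=> ia oi /negPf oj; rewrite /label_offset oi oj addn0.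
apply: leq_trans (leq_addl _ _); rewrite (eq_bigl (fun k : 'I_i => odd k)).
  exact: (@partial_sum_le odd).
by move=> k; exact: eqb_id.
Qed.

Lemma block_disjoint a i j x : (i < j < size a)%N ->
  x \in block a i -> x \in block a j -> False.
Proof.
move=> /andP[ij ja]; rewrite !mem_iota.
have ia := ltn_trans ij ja.
have [oij|] := eqVneq (odd i) (odd j).
  have := label_offset_parity a ij oij; lia.
case oi: (odd i); case oj: (odd j) => // _.
  have := @label_offset_odd a i j ia oi (negbT oj); lia.
have := @label_offset_odd a j i ja oj (negbT oi); lia.
Qed.

Lemma N_rel_poset a : is_labeled_poset (N_rel a).
Proof.
rewrite /N_rel -(big_mkord xpredT (fun i => antichain (block a i))).
suff H n : (n <= size a)%N ->
    is_labeled_poset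
      (\big[ordinal_sum/empty_rel]_(n <= i < size a) antichain (block a i)) /\
    forall x, x \in labels
      (\big[ordinal_sum/empty_rel]_(n <= i < size a) antichain (block a i)) ->
      exists2 i, (n <= i < size a)%N & x \in block a i.
  by case: (H 0%N).
move=> na; rewrite -(subKn na); move: (size a - n)%N (leq_subr n (size a)) => k.
elim: k => [|k IHk] ka.
  by rewrite subn0 big_geq.
have lt : (size a - k.+1 < size a)%N by lia.
rewrite big_ltn // (_ : (size a - k.+1).+1 = (size a - k)%N); last by lia.
case: (IHk (ltnW ka)) => IH1 IH2; split.
  apply: ordinal_sum_poset => //; last first.
    by apply: antichain_poset; apply/allP => x; rewrite mem_iota /=; lia.
  apply/fdisjointP => x; rewrite inE /= => xb; apply/negP => /IH2[j jr].
  by apply: block_disjoint xb; lia.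
move=> x; rewrite !inE /= => /orP[xb|/IH2[j jr xj]].
  by exists (size a - k.+1)%N => //; lia.
by exists j => //; lia.
Qed.

(* A_1 (+) ... (+) A_m, A_(i+1) being the antichain on [block a i]. *)
Definition N_poset (a : seq nat) : labeled_poset := LabeledPoset (N_rel_poset a).

Definition N (a : composition) : series :=
  if val a is [::] then series1 else posetQ (N_poset (val a)).

Definition lincomb (I : choiceType) (V : zmodType) (e : I -> V)
    (c : {fsfun I -> int with 0}) : V :=
  \sum_(i <- finsupp c) e i *~ c i.

(* The family e is a basis, over the integers, of the subgroup S of V. *)
Definition is_Zbasis (I : choiceType) (V : zmodType) (S : V -> Prop)
    (e : I -> V) : Prop :=
  (forall c : {fsfun I -> int with 0},
     lincomb e c = 0 -> forall i, c i = 0) /\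
  (forall v, S v <-> exists c : {fsfun I -> int with 0}, v = lincomb e c).

(* Main.v *)
Require Import Defs.
From mathcomp Require Import all_boot all_order all_algebra.
From mathcomp Require Import finmap zify.
From mathcomp Require Import boolp.

(** Both changes of basis, from the monomial basis to the fundamental one and
    from there to the N's, are unitriangular over the integers. The first is
    triangular for refinement. For the second, a linear extension of P_a is a
    concatenation of arbitrary orderings of the blocks, with a descent between
    A_i and A_(i+1) for i odd and an ascent for i even. Encode a permutation of
    length n by the word of its ascents (U) and descents (D), preceded by a U.
    The words arising from P_a are those reading U, D, U, D, ... at the first
    positions of the blocks A_1, A_2, A_3, A_4, ... The word U^a_1 D^a_2 U^a_3 ...
    arises exactly once, from the blocks written alternately in increasing and
    in decreasing order; any other word U^b_1 D^b_2 U^b_3 ... arising from P_a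
    has b lexicographically smaller than a. As every word starting with U is of
    the form U^b_1 D^b_2 ... for a unique composition b, the N_a are
    unitriangular in the fundamental basis. *)

Set Implicit Arguments.
Unset Strict Implicit.
Unset Printing Implicit Defensive.

Import GRing.Theory.
Local Open Scope fset_scope.
Local Open Scope ring_scope.

(** * Unitriangular changes of basis *)

Section Span.
Variables (I : choiceType) (V : zmodType).
Implicit Types (e f : I -> V) (c : {fsfun I -> int with 0}) (v : V).

(** Supports may shrink by cancellation, so combinations are compared over a common list. *)
Lemma lincomb_widen e c (s : seq I) : uniq s -> {subset finsupp c <= s} ->
  lincomb e c = \sum_(i <- s) e i *~ c i.
Proof.
move=> us cs; rewrite [RHS](bigID (mem (finsupp c))) /= [X in _ + X]big1 => [|i].
  rewrite addr0 -big_filter; apply: perm_big; apply: uniq_perm.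
  - exact: fset_uniq.
  - exact: filter_uniq.
  - by move=> i; rewrite mem_filter andb_idr // => /cs.
by move=> /fsfun_dflt ->; rewrite mulr0z.
Qed.

Definition in_span e v : Prop := exists c, v = lincomb e c.

Lemma in_span0 e : in_span e 0.
Proof. by exists [fsfun]; rewrite /lincomb finsupp0 big_seq_fset0. Qed.

Lemma in_spanD e v w : in_span e v -> in_span e w -> in_span e (v + w).
Proof.
move=> [c ->] [d ->]; pose T := finsupp c `|` finsupp d.
exists [fsfun i in T => c i + d i].
rewrite !(@lincomb_widen e _ T) ?fset_uniq //.
- rewrite -big_split /= big_seq [RHS]big_seq; apply: eq_bigr => i iT.
  by rewrite fsfunE iT mulrzDr.
- by move=> i; rewrite mem_finsupp fsfunE; case: ifP => //; rewrite eqxx.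
- by move=> i id; rewrite inE id orbT.
- by move=> i ic; rewrite inE ic.
Qed.

Lemma in_spanMz e v n : in_span e v -> in_span e (v *~ n).
Proof.
move=> [c ->]; exists [fsfun i in finsupp c => c i * n].
rewrite (@lincomb_widen e [fsfun i in finsupp c => c i * n] (finsupp c)).
- rewrite /lincomb mulrz_suml big_seq [RHS]big_seq; apply: eq_bigr => i ic.
  by rewrite fsfunE ic mulrzA.
- exact: fset_uniq.
- by move=> i; rewrite mem_finsupp fsfunE; case: ifP => //; rewrite eqxx.
Qed.

Lemma in_span_sum e (J : eqType) (r : seq J) (F : J -> V) :
  (forall j, j \in r -> in_span e (F j)) -> in_span e (\sum_(j <- r) F j).
Proof.
move=> h; rewrite big_seq; apply: big_ind => //.
- exact: in_span0.
- exact: in_spanD.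
Qed.

Lemma in_span_gen e i : in_span e (e i).
Proof.
exists [fsfun j in [fset i] => 1].
rewrite (@lincomb_widen _ _ [:: i]) ?big_seq1 ?fsfunE ?inE ?eqxx ?mulr1z //.
by move=> j; rewrite mem_finsupp fsfunE !inE; case: ifP => //; rewrite eqxx.
Qed.

Lemma in_span_trans e f v :
  (forall i, in_span e (f i)) -> in_span f v -> in_span e v.
Proof.
by move=> ef [c ->]; apply: in_span_sum => i _; apply: in_spanMz.
Qed.

Lemma sum_count_mem e (T s : seq I) : uniq T -> {subset s <= T} ->
  \sum_(j <- s) e j = \sum_(j <- T) e j *+ count_mem j s.
Proof.
move=> uT; elim: s => [|i s IHs] sT.
  by rewrite big_nil big1.
rewrite big_cons IHs => [|j js]; last by rewrite sT // inE js orbT.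
under [RHS]eq_bigr do rewrite /= mulrnDr.
rewrite big_split /=; congr (_ + _).
rewrite (bigD1_seq i) ?sT ?mem_head //= eqxx mulr1n big1 ?addr0 // => j.
by rewrite eq_sym => /negPf ->.
Qed.

(** Spanning: solving for [e i] leaves terms of smaller [mu], hence an induction. Independence:
    re-expansion in [e] keeps the coefficient of [d] at a support index of maximal [mu]. Repetitions
    in [s i] encode multiplicities. *)
Lemma Zbasis_unitriangular (S : V -> Prop) e f (mu : I -> nat) (s : I -> seq I) :
    is_Zbasis S e ->
    (forall i, f i = e i + \sum_(j <- s i) e j) ->
    (forall i j, j \in s i -> (mu j < mu i)%N) ->
  is_Zbasis S f.
Proof.
move=> [indep span] fE mus; split=> [d fd0|v]; last first.
  rewrite span; split; apply: in_span_trans => i; last first.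
    rewrite fE; apply: in_spanD; first exact: in_span_gen.
    by apply: in_span_sum => j _; exact: in_span_gen.
  have [n] := ubnP (mu i); elim: n i => // n IHn i ltn.
  have -> : e i = f i + (\sum_(j <- s i) e j) *~ (-1).
    by rewrite fE mulrNz mulr1z addrK.
  apply: in_spanD; first exact: in_span_gen.
  apply: in_spanMz; apply: in_span_sum => j /mus ji; apply: IHn.
  exact: leq_trans ji ltn.
(* [g] collects the coefficients of [lincomb f d] with respect to [e]; [T] contains every index that
   can occur. *)
pose T := finsupp d `|` [fset j in flatten [seq s i | i <- finsupp d]].
pose g : {fsfun I -> int with 0} := [fsfun j in T =>
  d j + \sum_(i <- finsupp d) d i *+ count_mem j (s i)].
have sT i : i \in finsupp d -> {subset s i <= T}.
  move=> id j ji; rewrite !inE /=; apply/orP; right.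
  by apply/flattenP; exists (s i) => //; exact: map_f.
have dT : {subset finsupp d <= T} by move=> i id; rewrite inE id.
have gE : lincomb e g = lincomb f d.
  rewrite (@lincomb_widen e g T) ?fset_uniq //; last first.
    by move=> i; rewrite mem_finsupp fsfunE; case: ifP => //; rewrite eqxx.
  transitivity (\sum_(j <- T) (e j *~ d j +
     \sum_(i <- finsupp d) e j *+ count_mem j (s i) *~ d i)).
    rewrite big_seq [RHS]big_seq; apply: eq_bigr => j jT.
    rewrite fsfunE jT mulrzDr mulrz_sumr; congr (_ + _).
    apply: eq_bigr => i _.
    by rewrite -[d i *+ _]mulr_natr mulrzA mulrzAC natz.
  rewrite big_split /= -(@lincomb_widen e d T) ?fset_uniq //.
  rewrite exchange_big /= -big_split /= big_seq [RHS]big_seq.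
  apply: eq_bigr => i id.
  rewrite fE mulrzDl (sum_count_mem e (fset_uniq T) (sT i id)).
  by rewrite -mulrz_suml.
have g0 := indep g; rewrite gE fd0 in g0; move/(_ erefl) in g0.
move=> i; apply/eqP; case: (finsuppP d i) => // id; exfalso.
have [k kd kmax] : exists2 k, k \in finsupp d &
    forall j, j \in finsupp d -> (mu j <= mu k)%N.
  pose P n := has (fun j => mu j == n) (finsupp d).
  have exP : exists n, P n by exists (mu i); apply/hasP; exists i.
  have ubP n : P n -> (n <= \max_(j <- finsupp d) mu j)%N.
    by case/hasP=> j jd /eqP <-; apply: leq_bigmax_seq.
  case: (ex_maxnP exP ubP) => n /hasP[k kd /eqP <-] kmax.
  by exists k => // j jd; apply: kmax; apply/hasP; exists j.
have := g0 k; rewrite fsfunE dT // big_seq big1 => [|j jd].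
  by rewrite addr0 => /eqP; move: kd; rewrite mem_finsupp => /negPf ->.
suff /count_memPn -> : k \notin s j by rewrite mulr0n.
by apply/negP => /mus; rewrite ltnNge kmax.
Qed.

Lemma Zbasis_reindex (S : V -> Prop) e (h : I -> I) :
  bijective h -> is_Zbasis S e -> is_Zbasis S (e \o h).
Proof.
move=> [k hK kH] [indep span]; split=> [c c0|v].
  pose T := [fset h i | i in finsupp c].
  have cT (d := [fsfun j in T => c (k j)] : {fsfun I -> int with 0}) i : d (h i) = c i.
    rewrite fsfunE hK; case: ifP => // /negP hi; apply/esym.
    by apply: fsfun_dflt; apply/negP => ic; apply: hi; apply: in_imfset.
  move=> i; rewrite -cT; apply: indep; rewrite -[RHS]c0.
  rewrite (@lincomb_widen _ _ T) ?fset_uniq //.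
    rewrite big_imfset /=; last by move=> x y _ _; exact: (can_inj hK).
    by apply: eq_bigr => j _; rewrite cT.
  by move=> j; rewrite mem_finsupp fsfunE; case: ifP => //; rewrite eqxx.
rewrite span; split; apply: in_span_trans => i; last exact: in_span_gen.
by rewrite -[i]kH; exact: (in_span_gen (e \o h)).
Qed.
End Span.

(** * The monomial and fundamental bases *)

Lemma series_sumE (J : Type) (r : seq J) (P : pred J) (F : J -> series)
    (m : monom) :
  (\sum_(j <- r | P j) F j) m = \sum_(j <- r | P j) F j m.
Proof. exact: (big_morph (fun f : series => f m)). Qed.

Lemma series_mulzE (f : series) (n : int) (m : monom) : (f *~ n) m = f m *~ n.
Proof.
have natE (k : nat) : (f *+ k) m = f m *+ k.
  by elim: k => // k IHk; rewrite !mulrS -IHk.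
case: n => k; first exact: natE.
by rewrite NegzE !mulrNz -[f m *~ _]natE.
Qed.

Lemma exponents_mkmonom (i a : seq nat) : is_comp a ->
  sorted ltn i -> size i = size a -> exponents (mkmonom i a) = a.
Proof. by move=> ca si sz; apply/eqP/exponentsP => //; exists i. Qed.

Lemma exponents_is_comp (m : monom) : is_comp (exponents m).
Proof.
apply/allP => k /mapP[j]; rewrite mem_sort mem_finsupp => mj ->.
by rewrite /= lt0n.
Qed.

Lemma mdegreeE (m : monom) : mdegree m = sumn (exponents m).
Proof.
rewrite sumnE big_map /mdegree; apply: perm_big.
by rewrite perm_sym; apply/permPl/perm_sort.
Qed.

Definition exponent_comp (m : monom) : composition :=
  exist _ (exponents m) (exponents_is_comp m).

Lemma exponent_comp_mkmonom (i : seq nat) (a : composition) :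
  sorted ltn i -> size i = size (val a) ->
  exponent_comp (mkmonom i (val a)) = a.
Proof.
by move=> si sz; apply: val_inj; rewrite /= exponents_mkmonom // (valP a).
Qed.

(** Each monomial occurs in exactly one monomial quasisymmetric function, so only one term
    contributes. *)
Lemma lincomb_monomialQE (c : {fsfun composition -> int with 0}) (m : monom) :
  lincomb (fun a : composition => monomialQ (val a)) c m = c (exponent_comp m).
Proof.
have ME (a : composition) :
    (monomialQ (val a) *~ c a) m = if a == exponent_comp m then c a else 0.
  rewrite series_mulzE /monomialQ -[a == _]/(val a == exponents m) eq_sym.
  by case: eqP => _; rewrite ?intz ?mul0rz.
rewrite /lincomb series_sumE; under eq_bigr do rewrite ME.
have [mc|mc] := finsuppP.
  rewrite big1_seq // => a /andP[_ ac]; case: eqP => // am.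
  by move: mc; rewrite -am ac.
rewrite (bigD1_seq (exponent_comp m)) ?fset_uniq //= eqxx.
by rewrite big1 ?addr0 // => a /negPf ->.
Qed.

Lemma monomialQ_Zbasis :
  is_Zbasis quasisymmetric (fun a : composition => monomialQ (val a)).
Proof.
split=> [c c0 a|f]; first (
  rewrite -(@exponent_comp_mkmonom (iota 0 (size (val a))) a) ?size_iota
          ?iota_ltn_sorted //; by rewrite -lincomb_monomialQE c0).
split=> [[[d fd] fq]|[c ->]]; last first.
  split=> [|a i j ca si sj szi szj].
    exists (\max_(a <- finsupp c) sumn (val a)) => m dm.
    rewrite lincomb_monomialQE; apply: fsfun_dflt; apply/negP => mc.
    move: dm; rewrite mdegreeE ltnNge => /negP; apply.
    exact: leq_bigmax_seq mc _.
  rewrite !lincomb_monomialQE; congr (c _); apply: val_inj => /=.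
  by rewrite !exponents_mkmonom.
(* As [d] bounds the degree of [f], the compositions of weight at most [d] suffice. Coefficients are
   read at the initial variables, to which quasisymmetry moves any monomial. *)
pose T : {fset composition} :=
  [fset a in pmap insub (flatten [seq comps n | n <- iota 0 d.+1])].
exists [fsfun a in T => f (mkmonom (iota 0 (size (val a))) (val a))].
apply/funext => m; rewrite lincomb_monomialQE fsfunE.
have -> : (exponent_comp m \in T) = (mdegree m <= d)%N.
  rewrite in_fset mem_pmap_sub mdegreeE; apply/flattenP/idP.
    move=> [s /mapP[n]]; rewrite mem_iota add0n ltnS => nd ->.
    by rewrite mem_comps => /andP[_ /eqP ->].
  move=> md; exists (comps (sumn (exponents m))).
    by apply: map_f; rewrite mem_iota.
  by rewrite mem_comps exponents_is_comp eqxx.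
case: leqP => [_|/fd //]; have cm := exponents_is_comp m.
have [i [si sz mE]] := exponentsP m cm (eqxx _).
by rewrite [in LHS]mE; apply: fq; rewrite ?size_iota ?iota_ltn_sorted.
Qed.

Lemma psums_cons2 x y s :
  psums [:: x, y & s] = x :: map (addn x) (psums (y :: s)).
Proof.
rewrite /psums /= ?take0 addn0; congr (_ :: _).
rewrite (iotaDl 1 1 (size s)) -!map_comp.
by apply: eq_map => k.
Qed.

Lemma psums_sorted s : is_comp s -> sorted ltn (psums s).
Proof.
elim: s => // x [|y s] IHs // /andP[x0 cs].
rewrite psums_cons2 [sorted _ _]/= (path_sortedE ltn_trans) sorted_map.
rewrite (@eq_sorted _ _ ltn) => [|u v]; last by rewrite /= ltn_add2l.
rewrite (IHs cs) andbT.
rewrite all_map; apply/allP => k /mapP[[|j]]; first by rewrite mem_iota.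
move=> _ -> /=; case/andP: cs => /=; lia.
Qed.

Lemma sumn_comp_eq0 s : is_comp s -> sumn s = 0%N -> s = [::].
Proof. by case: s => // -[|x] s. Qed.

(** The first partial sum is the first part. Equal weights settle the case of one part, where
    [psums] is empty. *)
Lemma psums_inj a b : is_comp a -> is_comp b -> sumn a = sumn b ->
  psums a = psums b -> a = b.
Proof.
elim: a b => [|x [|y a] IHa] b ca cb.
- by move=> /esym/(sumn_comp_eq0 cb).
- case: b cb => [|z [|w b]] cb; last by rewrite psums_cons2.
    by case: x ca.
  by rewrite /= !addn0 => ->.
- case: b cb => [|z [|w b]] cb; rewrite psums_cons2 //.
  rewrite psums_cons2 => sab [xz]; rewrite -xz in cb sab *.
  move=> /(inj_map (@addnI x)) pab; congr (_ :: _).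
  case/andP: ca => _ ca; case/andP: cb => _ cb; apply: IHa => //.
  by move: sab => /= /addnI.
Qed.

(** The partial sums of [a] are among those of [b]. If [b] had no more parts than [a], the two sets
    would agree, and [psums_inj] would give [a = b]. *)
Lemma refines_size a b : is_comp a -> is_comp b -> refines b a -> b != a ->
  (size a < size b)%N.
Proof.
move=> ca cb /andP[/eqP sab /allP pab] ba.
have uniq_psums s : is_comp s -> uniq (psums s).
  by move=> /psums_sorted; rewrite ltn_sorted_uniq_leq => /andP[].
have size_psums s : size (psums s) = (size s).-1 by rewrite size_map size_iota.
rewrite ltnNge; apply: contra ba => szba; apply/eqP/esym.
apply: psums_inj => //; apply: (irr_sorted_eq ltn_trans ltnn).
- exact: psums_sorted.
- exact: psums_sorted.
- have szp : (size (psums b) <= size (psums a))%N by rewrite !size_psums; lia.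
  by have [] := uniq_min_size (uniq_psums a ca) pab szp.
Qed.

Lemma refines_refl a : refines a a.
Proof. by rewrite /refines eqxx; apply/allP. Qed.

Lemma sum_rem (V : zmodType) (J : eqType) (r : seq J) (x : J) (F : J -> V) :
  x \in r -> \sum_(j <- r) F j = F x + \sum_(j <- rem x r) F j.
Proof. by move=> /perm_to_rem/(perm_big _) ->; rewrite big_cons. Qed.

Lemma size_le_sumn s : is_comp s -> (size s <= sumn s)%N.
Proof. by elim: s => // x s IHs /= /andP[x0 /IHs]; lia. Qed.

(** Apart from [a] itself only proper refinements occur; they have the same weight and more parts,
    so weight minus length drops. *)
Lemma fundamentalQ_Zbasis :
  is_Zbasis quasisymmetric (fun a : composition => fundamentalQ (val a)).
Proof.
pose r (a : seq nat) := [seq b <- comps (sumn a) | refines b a].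
pose s (a : composition) : seq composition :=
  pmap insub (rem (val a) (r (val a))).
have rE a b : (b \in r a) = is_comp b && refines b a.
  rewrite mem_filter mem_comps /refines; case: (is_comp b); rewrite ?andbF //=.
  by case: (sumn b == sumn a) => //=; rewrite andbT.
apply: (Zbasis_unitriangular (s := s) monomialQ_Zbasis
          (mu := fun a => sumn (val a) - size (val a))%N) => [a|a b].
  rewrite /fundamentalQ -big_filter (sum_rem _ (x := val a)); last first.
    by rewrite rE (valP a) refines_refl.
  congr (_ + _); rewrite -[RHS](big_map val xpredT monomialQ).
  rewrite (pmap_filter (insubK _)); congr (\sum_(b <- _) _); apply/esym/all_filterP.
  by apply/allP => b /mem_rem; rewrite rE => /andP[cb _]; rewrite insubT.
rewrite mem_pmap_sub mem_rem_uniq ?filter_uniq ?comps_uniq // inE rE.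
move=> /and3P[ba cb rba]; have := refines_size (valP a) cb rba ba.
by have := size_le_sumn cb; case/andP: rba => /eqP -> _ /=; lia.
Qed.

(** * Ascent words *)

Fixpoint zigzag (s : bool) (a : seq nat) : seq bool :=
  if a is x :: a' then nseq x s ++ zigzag (~~ s) a' else [::].

Fixpoint cut_runs (k : nat) (w : seq bool) : seq nat :=
  if w is u :: w' then
    if u then cut_runs k.+1 w' else k :: cut_runs 1 w'
  else [:: k].

(* The first letter of a word is a dummy: position 0 is neither an ascent nor a
   descent. *)
Definition word_comp (w : seq bool) : seq nat :=
  if w is _ :: w' then cut_runs 1 w' else [::].

(** When [p] is a later piece of a longer word, [s] holds the comparison with the entry before it;
    see [ascents_cat]. *)
Definition ascents (s : bool) (p : seq nat) : seq bool :=
  if p is x :: q then s :: pairmap ltn x q else [::].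

Lemma run_compE s p : run_comp p = word_comp (ascents s p).
Proof.
case: p => // x q /=; elim: q x 1%N => //= y q IHq x k.
by case: ifP => _; rewrite IHq.
Qed.

(** A first letter U makes the first part exceed [k]; a letter D or the end of the word makes it
    equal to [k], and only D leaves further parts. *)
Lemma cut_runs_inj k : injective (cut_runs k).
Proof.
have cutN0 j w : cut_runs j w != [::] by elim: w j => // -[] w IHw j /=.
have cut_head j w : (j <= head 0%N (cut_runs j w))%N.
  by elim: w j => // -[] w IHw j //=; apply: leq_trans (IHw _).
have cut_neq j w q : cut_runs j.+1 w = j :: q -> False.
  by move=> E; have := cut_head j.+1 w; rewrite E /= ltnn.
move=> u v; elim: u v k => [|b u IHu] [|c v] k //=.
- by case: c => [/esym/cut_neq|[] E] //; have := cutN0 1%N v; rewrite -E.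
- by case: b => [/cut_neq|[] E] //; have := cutN0 1%N u; rewrite E.
- by case: b c => [] [] => [/IHu ->|/cut_neq|/esym/cut_neq|[/IHu ->]].
Qed.

Lemma sumn_cut_runs k w : sumn (cut_runs k w) = (k + size w)%N.
Proof.
by elim: w k => [|[] w IHw] k /=; rewrite ?IHw ?addn0 ?addnS ?addSn // add0n.
Qed.

Lemma cut_runs_is_comp k w : (0 < k)%N -> is_comp (cut_runs k w).
Proof. by elim: w k => [|[] w IHw] k k0 /=; rewrite ?k0 ?IHw. Qed.

Lemma word_comp_is_comp w : is_comp (word_comp w).
Proof. by case: w => //= _ w; exact: cut_runs_is_comp. Qed.

Lemma sumn_word_comp w : sumn (word_comp w) = size w.
Proof. by case: w => //= _ w; rewrite /= sumn_cut_runs add1n. Qed.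

Lemma size_zigzag s a : size (zigzag s a) = sumn a.
Proof. by elim: a s => //= x a IHa s; rewrite size_cat size_nseq IHa. Qed.

Lemma size_ascents s p : size (ascents s p) = size p.
Proof. by case: p => //= x q; rewrite size_pairmap. Qed.

(* w reads s, ~~ s, s, ... at the first positions of the parts of b. *)
Fixpoint compat (s : bool) (b : seq nat) (w : seq bool) : bool :=
  if b is y :: b' then (head s w == s) && compat (~~ s) b' (drop y w) else true.

(* The binary number of sumn a digits, followed by a 0, with a 1 where a part of
   a starts: at fixed weight, it decreases for the lexicographic order. *)
Fixpoint lex_code (a : seq nat) : nat :=
  if a is x :: a' then (2 ^ (x + sumn a') + lex_code a')%N else 0%N.

Lemma lex_code_lt a : is_comp a -> (lex_code a < 2 ^ (sumn a).+1)%N.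
Proof.
elim: a => //= x a IHa /andP[x0 ca] /=; rewrite expnS mul2n -addnn ltn_add2l.
by apply: leq_trans (IHa ca) _; rewrite leq_exp2l //; lia.
Qed.

(** The leading digits cancel. The next digit 1 of [x :: a] is worth [2 ^ sumn a], which exceeds
    [lex_code b] because [sumn b < sumn a]. *)
Lemma lex_code_ltn_head x y a b : is_comp (x :: a) -> is_comp (y :: b) ->
  sumn (x :: a) = sumn (y :: b) -> (x < y)%N ->
  (lex_code (y :: b) < lex_code (x :: a))%N.
Proof.
move=> /andP[_ ca] /andP[_ cb] /= E xy; rewrite E ltn_add2l.
apply: leq_trans (lex_code_lt cb) _.
apply: (@leq_trans (2 ^ sumn a)); first by rewrite leq_exp2l //; lia.
by case: a ca E => [|z a] _ /= E; rewrite ?leq_addr //; lia.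
Qed.

(** Compare the first parts [x] of [a] and [y] of [b]: [x < y] decides the codes, [y < x]
    contradicts [compat], and [x = y] reduces to the tails. *)
Lemma compat_zigzag s a b : is_comp a -> is_comp b -> sumn a = sumn b ->
  compat s b (zigzag s a) -> b = a \/ (lex_code b < lex_code a)%N.
Proof.
elim: b s a => [|y b IHb] s a ca cb E.
  by move=> _; left; rewrite (sumn_comp_eq0 ca).
case: a ca E => [|x a] ca E; first by case/andP: cb => /=; move: E => /=; lia.
case/andP: (ca) => x0 ca'; case/andP: (cb) => y0 cb' /andP[_] /=.
have [xy|yx|xy] := ltngtP x y; first by right; apply: lex_code_ltn_head.
  (* Position [y] still lies in the first run of letters [s], while the second part of [b] starts
     there and requires [~~ s]. *)
  rewrite -(subnKC (ltnW yx)) nseqD -catA drop_size_cat ?size_nseq //.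
  case: b {IHb} E cb cb' => [|z b] /= E _ _; first by lia.
  have /prednK <- : (0 < x - y)%N by rewrite subn_gt0.
  by rewrite /=; case: s.
subst y; have sab : sumn a = sumn b by move: E => /addnI.
rewrite drop_size_cat ?size_nseq // => /(IHb _ _ ca' cb' sab)[->|lt]; first by left.
by right; rewrite sab ltn_add2l.
Qed.

Lemma compat_zigzag_refl s a : is_comp a -> compat s a (zigzag s a).
Proof.
elim: a s => //= x a IHa s /andP[x0 ca].
by rewrite drop_size_cat ?size_nseq // IHa //; case: x x0 => //= x _; rewrite eqxx.
Qed.

Lemma zigzag_inj s : {in is_comp &, injective (zigzag s)}.
Proof.
move=> a b ca cb E; have sab : sumn a = sumn b by rewrite -!(size_zigzag s) E.
have := compat_zigzag_refl s ca; rewrite E.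
case/(compat_zigzag cb ca (esym sab)) => // ltab.
have := compat_zigzag_refl s cb; rewrite -E.
by case/(compat_zigzag ca cb sab) => // /(ltn_trans ltab); rewrite ltnn.
Qed.

Lemma sorted_ascents s q :
  (ascents s q == nseq (size q) s) = sorted (fun x y => (x < y)%N == s) q.
Proof.
case: q => // x q; rewrite [LHS]eqseq_cons eqxx /=.
by elim: q x => //= y q IHq x; rewrite eqseq_cons IHq.
Qed.

Lemma ascents_cat s p q : p != [::] ->
  ascents s (p ++ q) = ascents s p ++ ascents (last 0%N p < head 0%N q)%N q.
Proof.
case: p => // x p _ /=; rewrite pairmap_cat; congr (_ :: _ ++ _).
by case: q.
Qed.

(** A constant word means a monotone arrangement, and distinct entries have one increasing and one
    decreasing arrangement. *)
Lemma ascents_perm s q b : sorted ltn b -> perm_eq q b ->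
  (ascents s q == nseq (size b) s) = (q == if s then b else rev b).
Proof.
move=> sb qb; rewrite -(perm_size qb) sorted_ascents.
have srev : sorted (fun x y => (x < y)%N == s) (if s then b else rev b).
  case: s; first by rewrite (eq_sorted (e' := ltn)) // => x y; case: ltnP.
  rewrite rev_sorted; apply: sub_sorted sb => x y xy.
  by rewrite ltnNge ltnW.
apply/idP/eqP => [sq|-> //].
have {}qb : perm_eq q (if s then b else rev b).
  by case: s {sq srev}; rewrite // perm_sym perm_rev perm_sym.
case: s sq srev qb => sq srev qb.
  apply: (irr_sorted_eq (leT := fun x y => (x < y)%N == true)) sq srev (perm_mem qb).
    by move=> y x z /eqP xy /eqP yz; rewrite (ltn_trans xy yz).
  by move=> x; rewrite ltnn.
apply: (sorted_eq (leT := fun x y => (x < y)%N == false)) sq srev qb.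
  by move=> y x z; rewrite !eqbF_neg -!leqNgt => yx zy; exact: leq_trans zy yx.
by move=> x y; rewrite !eqbF_neg -!leqNgt andbC => /anti_leq.
Qed.

Fixpoint block_perm (bs : seq (seq nat)) (p : seq nat) : bool :=
  if bs is b :: bs' then
    perm_eq (take (size b) p) b && block_perm bs' (drop (size b) p)
  else p == [::].

(** Passing from a block with first letter [s] to the next one must produce the letter [~~ s]; at
    the last block the condition is vacuous. *)
Fixpoint alternating (s : bool) (bs : seq (seq nat)) : bool :=
  if bs is b :: bs' then
    allrel (fun x y => (x < y)%N == ~~ s) b (head [::] bs') &&
    alternating (~~ s) bs'
  else true.

Fixpoint zigzag_perm (s : bool) (bs : seq (seq nat)) : seq nat :=
  if bs is b :: bs' then (if s then b else rev b) ++ zigzag_perm (~~ s) bs'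
  else [::].

Lemma block_perm_zigzag_perm s bs : block_perm bs (zigzag_perm s bs).
Proof.
elim: bs s => //= b bs IHbs s.
have sz : size (if s then b else rev b) = size b by case: s; rewrite ?size_rev.
rewrite -sz take_size_cat // drop_size_cat // IHbs andbT.
by case: s {sz} => //; rewrite perm_rev.
Qed.

(** The letter at the junction compares an entry of [b] with one of the next block, which
    [alternating] fixes as [~~ s]. *)
Lemma ascents_block s b bs p : all (predC1 [::]) (b :: bs) ->
  alternating s (b :: bs) -> block_perm (b :: bs) p ->
  ascents s p =
  ascents s (take (size b) p) ++ ascents (~~ s) (drop (size b) p).
Proof.
move=> /= /andP[b0 bs0] /andP[/allrelP alt _] /andP[tb].
have t0 : take (size b) p != [::].
  by apply: contra b0 => /eqP t0; move: tb; rewrite t0 perm_sym => /perm_nilP ->.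
rewrite -[in LHS](cat_take_drop (size b) p) ascents_cat //.
case: bs bs0 alt => [|b' bs] /= => [_ _ /eqP -> //|/andP[b'0 _] alt /andP[tb' _]].
congr (_ ++ ascents _ _); apply: (eqP (alt _ _ _ _)); rewrite -?(perm_mem tb) -?(perm_mem tb').
  by case: (take _ _) t0 => // x q _; exact: mem_last.
have : take (size b') (drop (size b) p) != [::].
  by apply: contra b'0 => /eqP t'0; move: tb'; rewrite t'0 perm_sym => /perm_nilP ->.
by case: (drop _ _) => //= x q; case: (size b') => //= n _; rewrite mem_head.
Qed.

Lemma size_take_block_perm b bs p : block_perm (b :: bs) p ->
  size (take (size b) p) = size b.
Proof. by case/andP=> /perm_size. Qed.

Lemma compat_ascents s bs p : all (predC1 [::]) bs -> alternating s bs ->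
  block_perm bs p -> compat s (shape bs) (ascents s p).
Proof.
elim: bs s p => //= b bs IHbs s p /[dup] bs0 /andP[_ bs0'] /[dup] alt /andP[_ alt'].
move=> /[dup] bp /andP[_ bp'].
have -> : head s (ascents s p) == s by case: p {bp bp'} => /=.
rewrite (ascents_block bs0 alt bp) drop_size_cat; first exact: IHbs.
by rewrite size_ascents (size_take_block_perm bp).
Qed.

(** The equation splits over the blocks, and [ascents_perm] leaves one arrangement in each. Hence
    the leading term has coefficient 1. *)
Lemma ascents_zigzag s bs p : all (predC1 [::]) bs -> all (sorted ltn) bs ->
  alternating s bs -> block_perm bs p ->
  (ascents s p == zigzag s (shape bs)) = (p == zigzag_perm s bs).
Proof.
elim: bs s p => [|b bs IHbs] s p bs0 sbs alt bp; first by rewrite /= (eqP bp).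
rewrite (ascents_block bs0 alt bp) /= -{3}(cat_take_drop (size b) p).
have sz := size_take_block_perm bp; move: bs0 sbs alt bp => /=.
move=> /andP[_ bs0] /andP[sb sbs] /andP[_ alt] /andP[tb bp].
rewrite !eqseq_cat ?size_ascents ?size_nseq ?sz ?ascents_perm ?IHbs //.
by case: s {alt}; rewrite ?size_rev.
Qed.

(** * Linear extensions of ordinal sums of antichains *)

(** A form of membership in [linear_extensions] that avoids positions and therefore splits along
    [take] and [drop]. *)
Definition is_linext (R : labeled_rel) (p : seq nat) : bool :=
  perm_eq p (labels R) && pairwise (fun x y => ~~ ((y != x) && lrel R y x)) p.

Lemma mem_linear_extensions (P : labeled_poset) p :
  (p \in linear_extensions P) = is_linext P p.
Proof.
rewrite mem_filter mem_permutations andbC /is_linext.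
have [pP|//] := boolP (perm_eq p (labels P)); rewrite !andTb.
have up : uniq p by rewrite (perm_uniq pP) fset_uniq.
apply/allP/(pairwiseP 0%N) => [le i j ip jp ij|le x xP].
  apply/negP; rewrite !inE in ip jp.
  have xP := mem_nth 0%N ip; have yP := mem_nth 0%N jp.
  rewrite (perm_mem pP) in xP; rewrite (perm_mem pP) in yP.
  move: (allP (le _ yP) _ xP) => /implyP/[apply].
  by rewrite !index_uniq // ltnNge ltnW.
apply/allP => y yP; apply/implyP => xy.
have xp : x \in p by rewrite (perm_mem pP).
have yp : y \in p by rewrite (perm_mem pP).
rewrite ltnNge leq_eqVlt; apply/norP; split.
  apply: contraTN xy => /eqP E; rewrite negb_and negbK.
  by rewrite -(nth_index 0%N xp) -E nth_index // eqxx.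
apply: contraL xy => yx.
by have := le _ _ _ _ yx; rewrite !inE !index_mem !nth_index // => ->.
Qed.

Definition lrel_on_labels (R : labeled_rel) : Prop :=
  forall x y, lrel R x y -> (x \in labels R) && (y \in labels R).

Lemma pairwise_partition (T : Type) (a : pred T) (p : seq T) :
  pairwise (fun x y => ~~ (~~ a x && a y)) p ->
  p = filter a p ++ filter (predC a) p.
Proof.
elim: p => //= x p IHp /andP[ap /IHp {1}->].
case: ifP => ax //=; have /size0nil -> // : size (filter a p) = 0%N.
apply/eqP; rewrite size_filter -leqn0 leqNgt -has_count -all_predC.
by apply: sub_all ap => y; rewrite /= ax.
Qed.

(** Labels of [P] must precede those of [Q], which fixes where [p] is cut. Conversely, disjointness
    excludes any relation from [Q] back to [P]. *)
Lemma is_linext_ordinal_sum P Q p :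
    lrel_on_labels P -> lrel_on_labels Q -> [disjoint labels P & labels Q]%fset ->
  is_linext (ordinal_sum P Q) p =
  is_linext P (take #|` labels P| p) && is_linext Q (drop #|` labels P| p).
Proof.
move=> onP onQ /fdisjointP dPQ; pose a x := x \in labels P.
have dQP x : x \in labels Q -> x \notin labels P.
  by move=> xQ; apply/negP => /dPQ; rewrite xQ.
apply/andP/andP => [[pp pw]|].
  have up : uniq p by rewrite (perm_uniq pp) fset_uniq.
  have pE : p = filter a p ++ filter (predC a) p.
    apply: pairwise_partition; move: pw; apply: (sub_in_pairwise (P := mem p)).
      move=> x y xp yp; apply: contra => /andP[xP yP].
      have : x \in labels P `|` labels Q by rewrite -(perm_mem pp).
      rewrite inE [x \in labels P](negPf xP) => /= xQ.
      rewrite (contraNneq _ xP) => [|yx]; last by rewrite -yx.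
      by rewrite /= [y \in _]yP xQ !orbT.
    by apply/allP.
  have aP : perm_eq (filter a p) (labels P).
    apply: uniq_perm; rewrite ?filter_uniq ?fset_uniq // => x.
    by rewrite mem_filter (perm_mem pp) !inE /a; case: (x \in labels P).
  have aQ : perm_eq (filter (predC a) p) (labels Q).
    apply: uniq_perm; rewrite ?filter_uniq ?fset_uniq // => x.
    rewrite mem_filter (perm_mem pp) !inE /= /a.
    by case xP: (x \in labels P) => //=; apply/esym/negbTE/dPQ.
  move: (filter a p) (filter (predC a) p) pE aP aQ => t d pE aP aQ; subst p.
  rewrite take_size_cat ?drop_size_cat ?(perm_size aP) //; move: pw.
  rewrite pairwise_cat => /and3P[_ pwP pwQ].
  rewrite /is_linext aP aQ; split.
    move: pwP; apply: sub_pairwise => x y; apply: contra => /andP[-> yx] /=.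
    by rewrite yx.
  move: pwQ; apply: sub_pairwise => x y; apply: contra => /andP[-> yx] /=.
  by rewrite yx orbT.
move=> [/andP[tP wP] /andP[dQ wQ]].
have pE := cat_take_drop #|` labels P| p.
split.
  apply: uniq_perm; rewrite ?fset_uniq //.
    rewrite -pE cat_uniq (perm_uniq tP) (perm_uniq dQ) !fset_uniq andbT /=.
    by apply/hasPn => x; rewrite (perm_mem dQ) (perm_mem tP) => /dQP.
  by move=> x; rewrite -[in LHS]pE mem_cat (perm_mem tP) (perm_mem dQ) !inE.
rewrite -pE pairwise_cat; apply/and3P; split.
- apply/allrelP => x y; rewrite (perm_mem tP) (perm_mem dQ) => xP yQ.
  apply/negP => /andP[_ /or3P[/onP/andP[yP _]|/onQ/andP[_ xQ]|/andP[yP _]]].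
  + by have := dQP _ yQ; rewrite yP.
  + by have := dQP _ xQ; rewrite xP.
  + by have := dQP _ yQ; rewrite yP.
- move: wP; apply: (sub_in_pairwise (P := mem (labels P))).
    move=> x y xP yP; apply: contra => /andP[-> /or3P[//|/onQ/andP[yQ _]|/andP[_ xQ]]].
      by have := dQP _ yQ; rewrite yP.
    by have := dQP _ xQ; rewrite xP.
  by apply/allP => x; rewrite (perm_mem tP).
- move: wQ; apply: (sub_in_pairwise (P := mem (labels Q))).
    move=> x y xP yP; apply: contra => /andP[-> /or3P[/onP/andP[yQ _]|//|/andP[yQ _]]].
      by have := dQP _ yP; rewrite yQ.
    by have := dQP _ yP; rewrite yQ.
  by apply/allP => x; rewrite (perm_mem dQ).
Qed.

Lemma is_linext_antichain b q : uniq b -> is_linext (antichain b) q = perm_eq q b.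
Proof.
move=> ub; rewrite /is_linext.
have /permPr -> : perm_eq (labels (antichain b)) b.
  by apply: uniq_perm; rewrite ?fset_uniq // => x; rewrite inE.
rewrite andb_idr // => _; apply/(pairwiseP 0%N) => i j _ _ _ /=.
by case: eqP; rewrite ?andbF.
Qed.

Lemma is_linext_antichains (bs : seq (seq nat)) p : uniq (flatten bs) ->
  is_linext (\big[ordinal_sum/empty_rel]_(b <- bs) antichain b) p =
  block_perm bs p.
Proof.
pose sum_of bs := \big[ordinal_sum/empty_rel]_(b <- bs) antichain b.
have labelsE cs : labels (sum_of cs) =i flatten cs.
  elim: cs => [|b cs IHcs] x; first by rewrite /sum_of big_nil.
  by rewrite /sum_of big_cons /= !inE mem_cat IHcs.
have on_antichain b : lrel_on_labels (antichain b).
  by move=> x y /andP[xb /eqP <-]; rewrite !inE xb.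
have on_sum cs : lrel_on_labels (sum_of cs).
  elim: cs => [|b cs IHcs]; first by rewrite /sum_of big_nil.
  rewrite /sum_of big_cons => x y /or3P[xy|/IHcs|] /=; rewrite !inE.
  - by case/andP: xy => xb /eqP <-; rewrite xb.
  - by case/andP => -> ->; rewrite !orbT.
  - by case/andP => -> ->; rewrite orbT.
elim: bs p => [|b bs IHbs] p /=.
  move=> _; rewrite big_nil /is_linext /=.
  case: p => //= x p; apply/negbTE; rewrite negb_and.
  by apply/orP; left; apply/negP => /perm_nilP.
rewrite cat_uniq => /and3P[ub /hasPn dis ubs].
rewrite big_cons is_linext_ordinal_sum //; last first.
- by apply/fdisjointP => x /=; rewrite inE labelsE; apply: contraL => /dis.
- exact: on_sum.
have -> : #|` labels (antichain b)| = size b by rewrite card_fseq undup_id.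
by rewrite is_linext_antichain // IHbs.
Qed.

Definition blocks (a : seq nat) : seq (seq nat) :=
  [seq block a i | i <- iota 0 (size a)].

Lemma shape_blocks a : shape (blocks a) = a.
Proof.
rewrite /shape /blocks -map_comp -[RHS](mkseq_nth 0%N); apply: eq_map => i /=.
by rewrite size_iota.
Qed.

Lemma blocks_uniq a : uniq (flatten (blocks a)).
Proof.
suff H n k : (k + n <= size a)%N -> uniq (flatten [seq block a i | i <- iota k n]).
  exact: H.
elim: n k => //= n IHn k kn.
rewrite cat_uniq iota_uniq IHn ?andbT; last by lia.
apply/hasPn => x /flattenP[_ /mapP[j + ->] xj]; rewrite mem_iota => kj.
by apply/negP => xk; apply: (block_disjoint _ xk xj); lia.
Qed.

(** Counting from 0, odd positions carry smaller labels than even ones, so leaving an even position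
    is a descent and leaving an odd one an ascent. *)
Lemma blocks_alternating a : alternating true (blocks a).
Proof.
suff H n k : (k + n <= size a)%N ->
    alternating (~~ odd k) [seq block a i | i <- iota k n].
  exact: (H _ 0%N).
elim: n k => //= n IHn k kn; rewrite (IHn k.+1) ?andbT; last by lia.
case: n {IHn} kn => [|n] kn /=; first by rewrite allrel0r.
apply/allrelP => x y; rewrite !mem_iota.
case ok: (odd k) => /=.
  have ki : (k < size a)%N by lia.
  have := @label_offset_odd a k k.+1 ki ok; rewrite /= ok => /(_ erefl).
  by move=> *; apply/eqP; lia.
have ki : (k.+1 < size a)%N by lia.
have := @label_offset_odd a k.+1 k ki; rewrite /= ok => /(_ erefl erefl).
by move=> *; apply/eqP; lia.
Qed.

Lemma blocks_sorted a : all (sorted ltn) (blocks a).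
Proof. by apply/allP => _ /mapP[i _ ->]; exact: iota_ltn_sorted. Qed.

Lemma blocks_neq0 a : is_comp a -> all (predC1 [::]) (blocks a).
Proof.
move=> ca; apply/allP => _ /mapP[i + ->]; rewrite mem_iota => /= ia.
rewrite -size_eq0 size_iota -lt0n.
by apply: (allP ca); rewrite mem_nth.
Qed.

Lemma mem_linear_extensions_N a p :
  (p \in linear_extensions (N_poset a)) = block_perm (blocks a) p.
Proof.
rewrite mem_linear_extensions -is_linext_antichains ?blocks_uniq //.
rewrite -[LHS]/(is_linext (N_rel a) p) /N_rel /blocks big_map.
rewrite -(big_mkord xpredT (fun i => antichain (block a i))).
by rewrite /index_iota subn0.
Qed.

(** * Unitriangularity over the fundamental basis *)

Lemma head_zigzag s a : is_comp a -> head s (zigzag s a) = s.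
Proof. by case: a => // -[]. Qed.

(** [word_comp] ignores the first letter, which the conditions on [head] restore. *)
Lemma word_comp_inj s u v : head s u = s -> head s v = s ->
  word_comp u = word_comp v -> u = v.
Proof.
move=> + + E; have : size u = size v by rewrite -!sumn_word_comp E.
by case: u v E => [|b u] [|c v] //= /cut_runs_inj -> _ -> ->.
Qed.

Lemma size_block_perm bs p : block_perm bs p -> size p = sumn (shape bs).
Proof.
elim: bs p => [|b bs IHbs] p /=; first by move=> /eqP ->.
by move=> /andP[/perm_size tb /IHbs <-]; rewrite -[in LHS](cat_take_drop (size b) p) size_cat tb.
Qed.

Definition zigzag_comp (a : composition) : composition :=
  exist _ (word_comp (zigzag true (val a))) (word_comp_is_comp _).

(** The map preserves weight and is injective, so it permutes the finitely many compositions of each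
    weight. *)
Lemma zigzag_comp_bij : bijective zigzag_comp.
Proof.
pose f a := word_comp (zigzag true a).
have f_inj : {in is_comp &, injective f}.
  move=> a b ca cb E; apply: (@zigzag_inj true) => //.
  by apply: (@word_comp_inj true) E; exact: head_zigzag.
have surj (c : composition) : exists a, zigzag_comp a == c.
  pose n := sumn (val c); have fc b : b \in comps n -> f b \in comps n.
    rewrite !mem_comps word_comp_is_comp sumn_word_comp size_zigzag.
    by case/andP.
  have uf : uniq (map f (comps n)).
    rewrite map_inj_in_uniq ?comps_uniq // => a b.
    by rewrite !mem_comps => /andP[ca _] /andP[cb _]; exact: f_inj.
  have sub : {subset map f (comps n) <= comps n} by move=> _ /mapP[b /fc + ->].
  have szf : (size (comps n) <= size (map f (comps n)))%N by rewrite size_map.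
  have [_ fE] := uniq_min_size uf sub szf.
  have : val c \in comps n by rewrite mem_comps (valP c) eqxx.
  rewrite -fE => /mapP[b]; rewrite mem_comps => /andP[cb _] cE.
  by exists (exist _ b cb); apply/eqP/val_inj.
pose g c := xchoose (surj c).
have gK : cancel g zigzag_comp by move=> c; apply/eqP; exact: (xchooseP (surj c)).
exists g => // a; apply/val_inj/f_inj; try exact: valP.
exact: (congr1 val (gK (zigzag_comp a))).
Qed.

Lemma run_comp_is_comp p : is_comp (run_comp p).
Proof. by rewrite (run_compE true) word_comp_is_comp. Qed.

(** For the empty composition the only linear extension is the empty word, which contributes
    [series1]. *)
Lemma NE (a : composition) : N a = posetQ (N_poset (val a)).
Proof.
rewrite /N; case aE: (val a) => //; rewrite /posetQ.
rewrite (perm_big [:: [::]]) ?big_seq1 ?fundamentalQ_nil //.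
apply: uniq_perm => [|//|p]; first by rewrite filter_uniq ?permutations_uniq.
by rewrite mem_linear_extensions_N !inE.
Qed.

Theorem theorem3p4 : is_Zbasis quasisymmetric N.
Proof.
have [h _ hK] := zigzag_comp_bij.
(* [p0 a] gives the leading term, at index [zigzag_comp a]; [s a] lists the other terms, reindexed
   by the inverse [h]. *)
pose p0 (a : composition) := zigzag_perm true (blocks (val a)).
pose s (a : composition) : seq composition :=
  [seq h (exist _ (run_comp p) (run_comp_is_comp p))
     | p <- rem (p0 a) (linear_extensions (N_poset (val a)))].
have asc_p0 (a : composition) p : p \in linear_extensions (N_poset (val a)) ->
    (ascents true p == zigzag true (val a)) = (p == p0 a).
  rewrite mem_linear_extensions_N -[X in zigzag _ X]shape_blocks.
  apply: ascents_zigzag (blocks_sorted _) (blocks_alternating _).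
  exact: blocks_neq0 (valP a).
have p0P (a : composition) : p0 a \in linear_extensions (N_poset (val a)).
  by rewrite mem_linear_extensions_N block_perm_zigzag_perm.
(* At fixed weight the subtraction reverses the order of codes, so [mu] drops as compositions get
   lexicographically smaller. *)
apply: (Zbasis_unitriangular (s := s)
  (mu := fun a => 2 ^ (sumn (val a)).+1 - lex_code (val a))%N
  (Zbasis_reindex zigzag_comp_bij fundamentalQ_Zbasis)) => [a|a _ /mapP[p + ->]].
  rewrite NE /posetQ (sum_rem _ (p0P a)) big_map; congr (_ + _).
    rewrite (run_compE true); have := asc_p0 a _ (p0P a).
    by rewrite eqxx => /eqP ->.
  by apply: eq_bigr => p _; rewrite [RHS]/comp hK.
rewrite mem_rem_uniq ?filter_uniq ?permutations_uniq // inE => /andP[pp0 pL].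
(* [h] inverts [zigzag_comp], so [j] is the composition whose zigzag word is the word of [p]. *)
set j := h _; have pE : ascents true p = zigzag true (val j).
  apply: (@word_comp_inj true); first by case: (p).
    exact/head_zigzag/valP.
  by rewrite -run_compE; have /(congr1 val) := hK (exist _ (run_comp p) (run_comp_is_comp p)).
have bp : block_perm (blocks (val a)) p by rewrite -mem_linear_extensions_N.
have szj : sumn (val j) = sumn (val a).
  by rewrite -(size_zigzag true) -pE size_ascents (size_block_perm bp) shape_blocks.
have := compat_ascents (blocks_neq0 (valP a)) (blocks_alternating _) bp.
rewrite shape_blocks pE => /(compat_zigzag (valP j) (valP a) szj)[aj|].
  (* If [j] were [a], then [p] would be [p0 a], which was removed from the list. *)
  by move: pp0; rewrite -asc_p0 // pE aj eqxx.
(* This bound keeps the truncated subtraction in [mu] strictly decreasing. *)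
have := lex_code_lt (valP j); rewrite szj => ltj lt_aj.
by apply: ltn_sub2l => //; exact: ltn_trans lt_aj ltj.
Qed.
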